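(* Let $L:\mathbb{R}^+\to\mathbb{R}^+$ be a measurable function such that $L(x)\to\infty$ as $x\to\infty$, and let $\rho\in\mathbb{R}$. (i) Suppose that $U\in\mathcal{M}_0^+(L,\rho)$. If $\rho>0$, then $U\in\mathcal{M}(\infty)$. If $\rho<0$, then $U\in\mathcal{M}(-\infty)$. (ii) Suppose that $U\in\mathcal{M}(\rho)$. Then $U\in\mathcal{M}_0^+(L,0)$.
   Context: $\mathbb{R}^+=(0,\infty)$; $a\ge 0$ is a fixed real number and $\int_a^x L(t)t^{-1}\,dt<\infty$ for every finite $x>a$. For $L$ as in the claim, $\mathcal{M}_0^+(L,\rho)$ is the class of positive measurable functions $U$ on $\mathbb{R}^+$, bounded on finite intervals, such that $\lim_{x\to\infty}\frac{\log U(x)}{\int_a^x L(t)t^{-1}\,dt}=\rho$. For $\rho\in\mathbb{R}\cup\{\pm\infty\}$, $\mathcal{M}(\rho)$ is the class of positive measurable functions $U$ on $\mathbb{R}^+$, bounded on finite intervals, such that $\lim_{x\to\infty}\frac{\log U(x)}{\log x}=\rho$. *)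

(* Defs.v *)
From mathcomp Require Import all_boot all_order all_algebra.
From mathcomp Require Import all_classical all_reals all_analysis.
Import Order.TTheory GRing.Theory Num.Theory.
Import numFieldNormedType.Exports.

Set Implicit Arguments.
Unset Strict Implicit.
Unset Printing Implicit Defensive.

Local Open Scope classical_set_scope.
Local Open Scope ring_scope.

(* Functions on (0, +oo) are encoded as total functions R -> R; every
   condition below only constrains their values on Rpos. *)
Definition Rpos (R : realType) : set R := `]0, +oo[%classic.

(* Finite intervals may touch 0, e.g. `]0, b[ is one of them. *)
Definition bounded_on_finite_intervals (R : realType) (U : R -> R) : Prop :=
  forall i : interval R,
    [set` i] `<=` @Rpos R -> bounded_set [set` i] ->
    [bounded U x | x in [set` i]].

Definition admissible (R : realType) (U : R -> R) : Prop :=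
  [/\ (forall x, 0 < x -> 0 < U x),
      measurable_fun (@Rpos R) U &
      bounded_on_finite_intervals U].

(* The left endpoint is excluded since L(t) / t is not defined at t = 0,
   and a = 0 is allowed. *)
Definition log_integral (R : realType) (a : R) (L : R -> R) (x : R) : \bar R :=
  \int[lebesgue_measure]_(t in `]a, x]) (L t / t)%:E.

Definition M0plus (R : realType) (a : R) (L : R -> R) (rho : R) :
    set (R -> R) :=
  [set U | admissible U /\
    (ln (U x) / fine (log_integral a L x)) @[x --> +oo] --> rho].

Definition M (R : realType) (rho : \bar R) : set (R -> R) :=
  [set U | admissible U /\ (ln (U x) / ln x)%:E @[x --> +oo] --> rho].

(* Main.v *)
Require Import Defs.
From mathcomp Require Import all_boot all_order all_algebra.
From mathcomp Require Import all_classical all_reals all_analysis.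
From mathcomp Require Import measurable_realfun ring.
Import Order.TTheory GRing.Theory Num.Theory.
Import numFieldNormedType.Exports.

Local Open Scope classical_set_scope.
Local Open Scope ring_scope.

(** Everything follows from one growth comparison: writing [I x] for the
    (finite) integral of [L t / t] from [a] to [x], the ratio [I x / ln x]
    tends to [+oo] ([log_integral_ln_cvgy]).  Indeed, once [L >= K] beyond
    some [X], the integral [I x] is at least [K * (ln x - ln X)]
    ([log_integral_ge]), which is eventually at least [(K / 2) * ln x], and
    [K] is arbitrary.

    Then [ln U / ln = (ln U / I) * (I / ln)]: a nonzero finite limit of the
    first factor forces the product to an infinite limit of the same sign,
    which is part (i).  Conversely [ln U / I = (ln U / ln) * (I / ln)^-1],
    where the first factor has a finite limit and the second tends to [0],
    which is part (ii). *)

Lemma ln_cvgy (R : realType) : @ln R x @[x --> +oo] --> +oo.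
Proof.
apply/cvgryPge => A; near=> x.
have Ax : expR A <= x by near: x; apply: nbhs_pinfty_ge; exact: num_real.
by rewrite -[A]expRK ler_ln ?posrE ?expR_gt0// (lt_le_trans (expR_gt0 A)).
Unshelve. all: by end_near. Qed.

(** Only the eventual lower bound [l / 2] of [f] is used, so the product
    outgrows every [A] as soon as [g] exceeds [`|A| / (l / 2)]. *)
Lemma pos_cvgM_cvgy (R : realFieldType) (T : Type) (F : set_system T)
    {FF : Filter F} (f g : T -> R) (l : R) : 0 < l ->
  f x @[x --> F] --> l -> g x @[x --> F] --> +oo ->
  (f x * g x) @[x --> F] --> +oo.
Proof.
move=> l0 fl gy; apply/cvgryPge => A; near=> x.
have fx : l / 2 <= f x.
  by near: x; apply: (cvgr_ge _ fl); rewrite ltr_pdivrMr// ltr_pMr// ltr1n.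
have gx : `|A| / (l / 2) <= g x by near: x; exact: cvgry_ge.
have l2 : 0 < l / 2 by rewrite divr_gt0.
rewrite (le_trans (ler_norm A))//.
rewrite -[leLHS](@divfK _ (l / 2)) ?gt_eqF// mulrC ler_pM//; first exact: ltW.
by rewrite divr_ge0// ltW.
Unshelve. all: by end_near. Qed.

Lemma measurable_fun_invr_itvoc (R : realType) (a x : R) : 0 <= a ->
  measurable_fun `]a, x] (fun t : R => t^-1).
Proof.
move=> a0.
have minv : measurable_fun (@Rpos R) (fun t : R => t^-1).
  apply: open_continuous_measurable_fun; first exact: interval_open.
  move=> t; rewrite inE /Rpos/= in_itv/= andbT => t0.
  by apply: inv_continuous; rewrite gt_eqF.
apply: measurable_funS minv; first exact: measurable_itv.
by move=> t; rewrite /Rpos/= !in_itv/= andbT => /andP[+ _]; exact: le_lt_trans.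
Qed.

Lemma integral_scaled_inv (R : realType) (K X x : R) : 0 < X -> X < x ->
  (\int[lebesgue_measure]_(t in `[X, x]) (K / t)%:E)%E
    = (K * (ln x - ln X))%:E.
Proof.
move=> X0 Xx.
have cln y : X <= y -> (fun t : R => K * ln t) @ y --> K * ln y.
  move=> Xy; apply: cvgMr; apply: continuous_ln; exact: lt_le_trans Xy.
have cinv y : X <= y -> (fun t : R => K / t) @ y --> K / y.
  move=> Xy; apply: cvgMr; apply: inv_continuous.
  by rewrite gt_eqF// (lt_le_trans X0).
rewrite (@continuous_FTC2 _ _ (fun t : R => K * ln t))//.
- by rewrite -EFinB mulrBr.
- apply: continuous_in_subspaceT => y; rewrite inE/= in_itv/= => /andP[Xy _].
  exact: cinv.
- split.
  + move=> y; rewrite in_itv/= => /andP[Xy _].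
    apply: derivableM => //; apply: ex_derive; apply: is_derive1_ln.
    exact: lt_trans Xy.
  + exact/cvg_at_right_filter/cln.
  + exact/cvg_at_left_filter/cln/ltW.
- move=> y; rewrite in_itv/= => /andP[Xy _].
  have dln := is_derive1_ln (lt_trans X0 Xy).
  rewrite derive1E.
  have -> : (fun t : R => K * ln t) = K *: @ln R by [].
  by rewrite deriveZ ?derive_val//; exact: ex_derive.
Qed.

(** Dropping the part of the integral below [X] and bounding [L] below by [K]
    on the rest leaves the integral of [K / t], which is a logarithm. *)
Lemma log_integral_ge (R : realType) (a K X x : R) (L : R -> R) : 0 <= a ->
  (forall t, 0 < t -> 0 < L t) -> measurable_fun (@Rpos R) L ->
  0 <= K -> a < X -> X < x -> (forall t, X <= t -> K <= L t) ->
  ((K * (ln x - ln X))%:E <= log_integral a L x)%E.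
Proof.
move=> a0 L0 mL K0 aX Xx KL.
have X0 : 0 < X by exact: le_lt_trans aX.
have mI : measurable_fun `]a, x] (fun t => (L t / t)%:E).
  apply/measurable_EFinP; apply: measurable_funM.
    apply: measurable_funS mL; first exact: measurable_itv.
    move=> t; rewrite /Rpos/= !in_itv/= andbT => /andP[+ _].
    exact: le_lt_trans.
  exact: measurable_fun_invr_itvoc.
have sub : `[X, x] `<=` `]a, x].
  by move=> t /=; rewrite !in_itv/= => /andP[Xt ->]; rewrite (lt_le_trans aX).
rewrite -integral_scaled_inv//.
apply: (@le_trans _ _ (\int[lebesgue_measure]_(t in `[X, x]) (L t / t)%:E)%E).
  apply: ge0_le_integral => //=.
  - move=> t; rewrite in_itv/= => /andP[Xt _].
    by rewrite lee_fin divr_ge0// (le_trans (ltW X0)).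
  - apply/measurable_EFinP; apply: measurable_funM => //.
    exact: (measurable_funS _ sub (measurable_fun_invr_itvoc _ _ _ a0)).
  - exact: (measurable_funS _ sub mI).
  - move=> t; rewrite in_itv/= => /andP[Xt _].
    rewrite lee_fin ler_pM2r ?KL// invr_gt0.
    exact: lt_le_trans Xt.
apply: ge0_subset_integral => //.
move=> t /=; rewrite in_itv/= => /andP[/(le_lt_trans a0) t0 _].
by rewrite lee_fin divr_ge0 ?ltW// L0.
Qed.

Lemma log_integral_ln_cvgy (R : realType) (a : R) (L : R -> R) : 0 <= a ->
  (forall x, 0 < x -> 0 < L x) -> measurable_fun (@Rpos R) L ->
  L x @[x --> +oo] --> +oo ->
  (forall x, a < x -> (log_integral a L x < +oo)%E) ->
  (fine (log_integral a L x) / ln x) @[x --> +oo] --> +oo.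
Proof.
move=> a0 L0 mL Ly Ifin; apply/cvgryPge => A.
(* The factor 2 pays for the loss of [ln X], at most half of [ln x] for
   large [x]; the absolute value makes [K] a nonnegative bound for [L]. *)
pose K := 2 * `|A|.
have [M [_ ML]] := (cvgryPge _).1 Ly K.
pose X := Num.max a M + 1.
have aX : a < X by rewrite ltr_pwDr// le_max lexx.
have MX : M < X by rewrite ltr_pwDr// le_max lexx orbT.
near=> x.
have Xx : X < x by near: x; apply: nbhs_pinfty_gt; exact: num_real.
have lnX : 2 * ln X <= ln x by near: x; apply: (cvgry_ge (ln_cvgy R)).
have lnx : 0 < ln x by near: x; exact: (cvgry_gt (ln_cvgy R)).
rewrite ler_pdivlMr// (@le_trans _ _ (K * (ln x - ln X)))//.
  rewrite (@le_trans _ _ (`|A| * ln x))//.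
    by rewrite ler_pM2r// ler_norm.
  rewrite /K -mulrA [2 * _]mulrC -mulrA ler_wpM2l//.
  rewrite -subr_ge0 (_ : _ - _ = ln x - 2 * ln X); last by ring.
  by rewrite subr_ge0.
rewrite -lee_fin fineK; last first.
  rewrite ge0_fin_numE ?Ifin ?(lt_trans aX)//.
  apply: integral_ge0 => t /=; rewrite in_itv/= => /andP[/(le_lt_trans a0) t0 _].
  by rewrite lee_fin divr_ge0 ?ltW// L0.
apply: log_integral_ge => //.
  by rewrite mulr_ge0.
by move=> t Xt; apply: ML; exact: lt_le_trans Xt.
Unshelve. all: by end_near. Qed.

Theorem proposition2p16 (R : realType) (a : R) (a_ge0 : 0 <= a)
    (L : R -> R) (L_gt0 : forall x, 0 < x -> 0 < L x)
    (L_meas : measurable_fun (@Rpos R) L)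
    (L_lim : L x @[x --> +oo] --> +oo)
    (L_int : forall x, a < x -> (log_integral a L x < +oo)%E)
    (rho : R) :
  (forall U : R -> R, M0plus a L rho U ->
     (0 < rho -> M +oo%E U) /\ (rho < 0 -> M -oo%E U)) /\
  (forall U : R -> R, M rho%:E U -> M0plus a L 0 U).
Proof.
have Iln : (fine (log_integral a L x) / ln x) @[x --> +oo] --> +oo.
  exact: log_integral_ln_cvgy.
have Iln_gt0 : \forall x \near +oo, 0 < fine (log_integral a L x) / ln x.
  exact: (cvgry_gt Iln).
have ln_gt0 : \forall x \near +oo, 0 < @ln R x by exact: (cvgry_gt (ln_cvgy R)).
split=> [U [admU UI]|U [admU Uln]].
- have factor : \forall x \near +oo,
      ln (U x) / fine (log_integral a L x) * (fine (log_integral a L x) / ln x)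
      = ln (U x) / ln x.
    near=> x; rewrite mulrA divfK//.
    (* The integral can be cancelled because its ratio to [ln x] is
       eventually positive. *)
    have : fine (log_integral a L x) / ln x != 0.
      by rewrite gt_eqF//; near: x.
    by rewrite mulf_eq0 negb_or => /andP[].
  split=> [rho_gt0|rho_lt0]; split=> //.
  + apply/cvgeryP.
    apply: (cvg_trans (near_eq_cvg factor)).
    exact: pos_cvgM_cvgy UI Iln.
  + apply/cvgerNyP.
    apply: (cvg_trans (near_eq_cvg factor)).
    apply/cvgNry.
    have Nrho_gt0 : 0 < - rho by rewrite oppr_gt0.
    have NUI : - (ln (U x) / fine (log_integral a L x)) @[x --> +oo] --> - rho.
      exact: cvgN.
    have : - (ln (U x) / fine (log_integral a L x))
        * (fine (log_integral a L x) / ln x) @[x --> +oo] --> +oo.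
      exact: pos_cvgM_cvgy NUI Iln.
    by under eq_fun do rewrite mulNr.
- split=> //.
  have lnI : (fine (log_integral a L x) / ln x)^-1 @[x --> +oo] --> (0 : R).
    exact: (gtr0_cvgV0 Iln_gt0).2.
  have Uln' : (ln (U x) / ln x) @[x --> +oo] --> rho by exact: (fine_cvg Uln).
  have lim0 : ln (U x) / ln x * (fine (log_integral a L x) / ln x)^-1
      @[x --> +oo] --> (0 : R).
    by rewrite -[X in _ --> X](mulr0 rho); exact: cvgM.
  apply: cvg_trans lim0; apply: near_eq_cvg; near=> x.
  rewrite invf_div mulrA divfK// gt_eqF//.
  by near: x.
Unshelve. all: by end_near. Qed.
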